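(* Let $\{X_\gamma:\gamma\in\Gamma\}$ be an infinite family of compact metric spaces (i.e. the index set $\Gamma$ is infinite) such that $|X_\gamma|\ge 2$ for all $\gamma\in\Gamma$. Set $X=\prod_{\gamma\in\Gamma}X_\gamma$ with the product topology. Then $m(C(X))=|\Gamma|$.
   Context: For a compact Hausdorff space $X$, $C(X)$ is the Banach space of continuous real functions on $X$ with the supremum norm. A subset $S$ of a metric space $(M,d)$ is equilateral if there is $\lambda>0$ with $d(x,y)=\lambda$ for all distinct $x,y\in S$. An equilateral set $A\subseteq M$ is maximal if there is no equilateral set $B\subseteq M$ with $A\subsetneq B$. $m(M)=\min\{|A|: A \text{ is a maximal equilateral set in } M\}$ (a cardinal). A normed space is regarded as a metric space via its norm. *)

(* Defs.v *)
From HB Require Import structures.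
From mathcomp Require Import all_boot all_order all_algebra.
From mathcomp Require Import all_classical all_reals all_analysis.

Set Implicit Arguments.
Unset Strict Implicit.
Unset Printing Implicit Defensive.

Import Order.TTheory GRing.Theory Num.Theory.
Import numFieldNormedType.Exports.

Local Open Scope classical_set_scope.
Local Open Scope card_scope.
Local Open Scope ring_scope.

Section equilateral.
Context {R : realType} {M : metricType R}.

Definition equilateral (S : set M) : Prop :=
  exists2 l : R, 0 < l &
    forall x y : M, S x -> S y -> x <> y -> mdist x y = l.

Definition maximal_equilateral (A : set M) : Prop :=
  equilateral A /\ ~ exists2 B : set M, equilateral B & A `<` B.

End equilateral.

(* The library has no type of cardinals: [is_m M K] says m(M) = |K|, that is,
   |K| belongs to { |A| : A maximal equilateral in M } and is a lower bound of
   it.  By Cantor-Bernstein this determines |K|. *)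
Definition is_m {R : realType} (M : metricType R) {U : Type} (K : set U) :
    Prop :=
  (exists2 A : set M, maximal_equilateral A & A #= K) /\
  (forall A : set M, maximal_equilateral A -> K #<= A).

(* C(X); compactness of X is a parameter of the type because the supremum norm
   below is a norm only on bounded functions.  The Hausdorff property plays no
   role in the construction. *)
Definition Cspace (R : realType) (X : topologicalType)
  (cX : compact [set: X]) : Type := continuousType X R.

Section Cspace_lmodule.
Context {R : realType} {X : topologicalType} (cX : compact [set: X]).
Notation C := (Cspace R cX).

HB.instance Definition _ := Choice.copy C (continuousType X R).

Implicit Types f g h : C.

Let addC_cts f g : continuous (fun x => (f : X -> R) x + (g : X -> R) x).
Proof. by move=> x; apply: cvgD; exact: cts_fun. Qed.

Let oppC_cts f : continuous (fun x => - (f : X -> R) x).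
Proof. by move=> x; apply: cvgN; exact: cts_fun. Qed.

Let scaleC_cts (a : R) f : continuous (fun x => a * (f : X -> R) x).
Proof. by move=> x; apply: cvgM; [exact: cvg_cst|exact: cts_fun]. Qed.

Let zeroC : C := (cst 0 : X -> R).
Let addC f g : C := mkcts (@addC_cts f g).
Let oppC f : C := mkcts (@oppC_cts f).
Let scaleC a f : C := mkcts (@scaleC_cts a f).

Let addCA : associative addC.
Proof. by move=> f g h; apply/continuousEP => x; exact: addrA. Qed.
Let addCC : commutative addC.
Proof. by move=> f g; apply/continuousEP => x; exact: addrC. Qed.
Let add0C : left_id zeroC addC.
Proof. by move=> f; apply/continuousEP => x; exact: add0r. Qed.
Let addNC : left_inverse zeroC oppC addC.
Proof. by move=> f; apply/continuousEP => x; exact: addNr. Qed.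

HB.instance Definition _ := GRing.isZmodule.Build C addCA addCC add0C addNC.

Let scaleCA a b f : scaleC a (scaleC b f) = scaleC (a * b) f.
Proof. by apply/continuousEP => x; exact: mulrA. Qed.
Let scale1C : left_id 1 scaleC.
Proof. by move=> f; apply/continuousEP => x; exact: mul1r. Qed.
Let scaleCDr : right_distributive scaleC +%R.
Proof. by move=> a f g; apply/continuousEP => x; exact: mulrDr. Qed.
Let scaleCDl f : {morph scaleC^~ f : a b / a + b}.
Proof. by move=> a b; apply/continuousEP => x; exact: mulrDl. Qed.

HB.instance Definition _ :=
  GRing.Zmodule_isLmodule.Build R C scaleCA scale1C scaleCDr scaleCDl.

Lemma CspaceD f g x : (f + g : C) x = f x + g x. Proof. by []. Qed.
Lemma CspaceN f x : (- f : C) x = - f x. Proof. by []. Qed.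
Lemma CspaceZ (a : R) f x : (a *: f : C) x = a * f x. Proof. by []. Qed.
Lemma Cspace0 x : (0 : C) x = 0. Proof. by []. Qed.

End Cspace_lmodule.

Section Cspace_norm.
Context {R : realType} {X : topologicalType} (cX : compact [set: X]).
Notation C := (Cspace R cX).
Implicit Types f g : C.

(* For empty X this is sup set0 = 0, as it should be. *)
Definition sup_norm f : R := sup [set `|f x| | x in [set: X]].

Lemma sup_norm_has_ubound f : has_ubound [set `|f x| | x in [set: X]].
Proof.
have cf : compact ((fun x => `|f x|) @` [set: X]).
  apply: continuous_compact => //; apply: continuous_subspaceT => x.
  by apply: cvg_norm; exact: cts_fun.
have [B [_ Bf]] := compact_bounded cf.
exists (B + 1) => _ [x _ <-].
have ltB : B < B + 1 by rewrite ltrDl.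
have fxC : ((fun y => `|f y|) @` [set: X]) `|f x| by exists x.
by have := Bf _ ltB _ fxC; rewrite /= normr_id.
Qed.

Lemma le_sup_norm f x : `|f x| <= sup_norm f.
Proof. by apply: ub_le_sup; [exact: sup_norm_has_ubound|exists x]. Qed.

Lemma sup_norm_le f (r : R) :
  0 <= r -> (forall x, `|f x| <= r) -> sup_norm f <= r.
Proof.
move=> r0 fr; rewrite /sup_norm.
have [->|/set0P ne0] := eqVneq [set `|f x| | x in [set: X]] set0.
  by rewrite sup0.
by apply: ge_sup => // _ [x _ <-].
Qed.

Lemma sup_norm_ge0 f : 0 <= sup_norm f.
Proof.
rewrite /sup_norm.
have [->|/set0P [_ [x _ _]]] := eqVneq [set `|f x| | x in [set: X]] set0.
  by rewrite sup0.
exact: le_trans (le_sup_norm f x).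
Qed.

Let sup_normD f g : sup_norm (f + g) <= sup_norm f + sup_norm g.
Proof.
apply: sup_norm_le => [|x]; first by rewrite addr_ge0 // sup_norm_ge0.
by rewrite CspaceD (le_trans (ler_normD _ _)) // lerD // le_sup_norm.
Qed.

Let sup_normZ (a : R) f : sup_norm (a *: f) = `|a| * sup_norm f.
Proof.
have le b g : sup_norm (b *: g) <= `|b| * sup_norm g.
  apply: sup_norm_le => [|x]; first by rewrite mulr_ge0 // sup_norm_ge0.
  by rewrite CspaceZ normrM ler_wpM2l // le_sup_norm.
have [->|a0] := eqVneq a 0.
  apply/eqP; rewrite eq_le le /= normr0 mul0r; exact: sup_norm_ge0.
apply/eqP; rewrite eq_le le /= -ler_pdivlMl ?normr_gt0 //.
by rewrite -normfV -{1}(scale1r f) -(mulVf a0) -scalerA le.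
Qed.

Let sup_norm_eq0 f : sup_norm f = 0 -> f = 0.
Proof.
move=> f0; apply/continuousEP => x; rewrite Cspace0.
by apply/eqP; rewrite -normr_le0 -f0 le_sup_norm.
Qed.

HB.instance Definition _ :=
  Lmodule_isNormed.Build R C sup_normD sup_normZ sup_norm_eq0.

Lemma Cspace_normE f : `|f| = sup_norm f. Proof. by []. Qed.

Let mdistC_ge0 f g : 0 <= `|f - g|. Proof. exact: normr_ge0. Qed.

Let mdistC_positivity f g : `|f - g| = 0 -> f = g.
Proof. by move/normr0_eq0/subr0_eq. Qed.

Let ballEmdistC f (d : R) : ball f d = [set g | `|f - g| < d].
Proof. by rewrite -ball_normE. Qed.

HB.instance Definition _ :=
  PseudoMetric_isMetric.Build R C mdistC_ge0 mdistC_positivity ballEmdistC.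

Lemma Cspace_mdistE f g : mdist f g = `|f - g|. Proof. by []. Qed.

End Cspace_norm.

Lemma compact_prod_topology (I : Type) (T : I -> topologicalType) :
  (forall i, compact [set: T i]) -> compact [set: prod_topology T].
Proof.
move=> cT; have := @tychonoff {classic I} T (fun i => [set: T i]) cT.
by congr (compact _); apply/seteqP; split.
Qed.

(* Main.v *)
(* Lower bound.  Let A be an equilateral set of distance l.  If A is finite,
   choose points y_f (where the distances are attained) and a further point z;
   for the member f0 of A that is smallest at z, a function g with
   f0 <= g <= min_f f + l, equal to f0 at the y_f and to f0 + l at z, extends A.
   If A is infinite and |A| < |Gamma|, then, as every continuous function on the
   product depends on countably many coordinates only, some coordinate is
   ignored by all of A; for f0 <> f1 in A and a Urysohn function t of that
   coordinate, (1 - t) f0 + t f1 extends A.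
   Upper bound.  Up to e, a continuous function is determined by finitely many
   pairs (basic box, rational), so equilateral sets have at most |Gamma|
   elements, and a maximal one exists by Zorn's lemma.  Both parts rest on
   |T * T| = |T| for infinite T. *)
From HB Require Import structures.
Require Import Defs.
From mathcomp Require Import all_boot all_order all_algebra.
From mathcomp Require Import ring lra.
From mathcomp Require Import all_classical all_reals all_analysis.

Set Implicit Arguments.
Unset Strict Implicit.
Unset Printing Implicit Defensive.

Import Order.TTheory GRing.Theory Num.Theory.
Import numFieldNormedType.Exports.

Local Open Scope classical_set_scope.
Local Open Scope card_scope.

(** * Cardinal arithmetic *)

(* Relations instead of functions, so that no point of the target is needed. *)
Lemma card_le_relP T U (A : set T) (B : set U) :
  A #<= B <-> exists R : T -> U -> Prop,
    (forall a, A a -> exists2 b, B b & R a b) /\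
    (forall a a' b, R a b -> R a' b -> a = a').
Proof.
split=> [/card_leP[f]|[R [totR injR]]].
  exists (fun a b => exists u : A, val u = a /\ val (f u) = b); split.
    move=> a /mem_set aA; exists (val (f (SigSub aA))); first exact: set_valP.
    by exists (SigSub aA).
  by move=> _ _ b [u [<- <-]] [v [<- /val_inj/(inj (mem_set I) (mem_set I))->]].
have /choice[f fP] : forall a : A, exists b : B, R (val a) (val b).
  move=> a; have [b /mem_set bB Rab] := totR _ (set_valP a).
  by exists (SigSub bB).
apply/card_leP/injfunPex; exists f => //.
by move=> a a' _ _ e; apply/val_inj/(injR _ _ _ (fP a)); rewrite e; exact: fP.
Qed.

Lemma card_leTP T U :
  [set: T] #<= [set: U] <-> exists f : T -> U, injective f.
Proof.
split=> [/card_le_relP[R [totR injR]]|[f injf]].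
  have /choice[f fP] : forall a, exists b, R a b.
    by move=> a; have [b] := totR a I; exists b.
  by exists f => a a' e; apply: injR (fP a) _; rewrite e.
apply/card_le_relP; exists (fun a b => f a = b).
split=> [a _|a a' b <- /injf//].
by exists (f a).
Qed.

Lemma card_le_funP T U (A : set T) (B : set U) : A !=set0 ->
  A #<= B -> exists2 f : T -> U, set_fun A B f & set_inj A f.
Proof.
move=> [a0 A0] /card_le_relP[R [totR injR]]; have [b0 _ _] := totR _ A0.
have /choice[f fP] : forall a, exists b, A a -> B b /\ R a b.
  move=> a; have [/totR[b]|] := pselect (A a); last by exists b0.
  by exists b.
exists f => [a /fP[]//|a a' /set_mem /fP[_ Ra] /set_mem /fP[_ Ra'] e].
by apply: injR Ra _; rewrite e.
Qed.

Lemma card_leX T T' U U' (A : set T) (A' : set T') (B : set U) (B' : set U') :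
  A #<= B -> A' #<= B' -> A `*` A' #<= B `*` B'.
Proof.
move=> /card_le_relP[R [totR injR]] /card_le_relP[R' [totR' injR']].
apply/card_le_relP; exists (fun p q => R p.1 q.1 /\ R' p.2 q.2); split.
  move=> [a a'] [/totR[b Bb Rb] /totR'[b' Bb' Rb']].
  by exists (b, b').
move=> [a a'] [c c'] [b b'] /= [ab ab'] [cb cb'].
by rewrite (injR _ _ _ ab cb) (injR' _ _ _ ab' cb').
Qed.

Lemma card_le_total T U (A : set T) (B : set U) : A #<= B \/ B #<= A.
Proof.
pose P (G : set (T * U)) := [/\ G `<=` A `*` B,
  forall a b b', G (a, b) -> G (a, b') -> b = b' &
  forall a a' b, G (a, b) -> G (a', b) -> a = a'].
have [F FP totF|G [[GAB fG iG] maxG]] := @Zorn_bigcup _ P.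
  have common p q : (\bigcup_(X in F) X) p -> (\bigcup_(X in F) X) q ->
      exists X, [/\ F X, X p & X q].
    move=> [X FX Xp] [Y FY Yq].
    by have [/(_ _ Xp)|/(_ _ Yq)] := totF _ _ FX FY; [exists Y|exists X].
  split.
  - by move=> p [X /FP[XAB _ _] /XAB].
  - by move=> a b b' /common/[apply] -[X [/FP[_ + _]]]; apply.
  - by move=> a a' b /common/[apply] -[X [/FP[_ _]]]; apply.
have [[a [Aa na]]|Adom] := pselect (exists a, A a /\ forall b, ~ G (a, b)).
  have [[b [Bb nb]]|Bran] := pselect (exists b, B b /\ forall a, ~ G (a, b)).
    exfalso; apply: (maxG (G `|` [set (a, b)])).
      split; first by move=> p Gp; left.
      by move=> /(_ (a, b)) H; apply: (na b); apply: H; right.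
    split.
    - by move=> p [/GAB//|->].
    - move=> x y y' [Gxy|[ex ey]] [Gxy'|[ex' ey']].
      + exact: fG Gxy'.
      + by case: (na y); rewrite -ex'.
      + by case: (na y'); rewrite -ex.
      + by rewrite ey ey'.
    - move=> x x' y [Gxy|[ex ey]] [Gxy'|[ex' ey']].
      + exact: iG Gxy'.
      + by case: (nb x); rewrite -ey'.
      + by case: (nb x'); rewrite -ey.
      + by rewrite ex ex'.
  right; apply/card_le_relP; exists (fun b a => G (a, b)); split.
    move=> b Bb; apply: contrapT => nb; apply: Bran; exists b; split=> // x Gx.
    by apply: nb; exists x => //; have [] := GAB _ Gx.
  by move=> b b' x; exact: fG.
left; apply/card_le_relP; exists (fun a b => G (a, b)); split.
  move=> x Ax; apply: contrapT => nx; apply: Adom; exists x; split=> // y Gy.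
  by apply: nx; exists y => //; have [] := GAB _ Gy.
by move=> x x' y; exact: iG.
Qed.

(** Two distinct points [s0], [s1] of [S] serve as tags, so that the union embeds into [S * S]. *)
Lemma card_leU T U (A B : set T) (S : set U) : infinite_set S ->
  S `*` S #<= S -> A #<= S -> B #<= S -> A `|` B #<= S.
Proof.
move=> infS SS AS BS; apply: card_le_trans SS.
have [s0 S0] := infinite_setN0 infS.
have [s1 [S1 s10]] : (S `\` [set s0]) !=set0.
  by apply/infinite_setN0/infinite_setD => //; exact: finite_set1.
move: AS BS => /card_le_relP[R [totR injR]] /card_le_relP[R' [totR' injR']].
apply/card_le_relP; exists (fun x p =>
  (R x p.1 /\ p.2 = s0) \/ (R' x p.1 /\ p.2 = s1)); split.
  move=> x [/totR[b Sb Rb]|/totR'[b Sb Rb]].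
    by exists (b, s0) => //; left.
  by exists (b, s1) => //; right.
move=> a a' [b c] /= [[Ra c0]|[Ra c1]] [[Ra' c0']|[Ra' c1']].
- exact: injR Ra'.
- by case: s10; rewrite -c1' c0.
- by case: s10; rewrite -c1 c0'.
- exact: injR' Ra'.
Qed.

Section infinite_square.
Variables (T : Type) (infT : infinite_set [set: T]).

(** The graphs considered are defined on full squares, so the side of the square can be read off the
    diagonal. *)
Let dom (G : set ((T * T) * T)) : set T := [set x | exists z, G ((x, x), z)].

Let P (G : set ((T * T) * T)) := [/\
  forall x y z, G ((x, y), z) -> [/\ dom G x, dom G y & dom G z],
  forall x y, dom G x -> dom G y -> exists z, G ((x, y), z) &
  forall p q z, G (p, z) -> G (q, z) -> p = q].

Let P_bigcup F : F `<=` P -> total_on F subset -> P (\bigcup_(X in F) X).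
Proof.
move=> FP totF; have common p q : (\bigcup_(X in F) X) p ->
    (\bigcup_(X in F) X) q -> exists X, [/\ F X, X p & X q].
  move=> [X FX Xp] [Y FY Yq].
  by have [/(_ _ Xp)|/(_ _ Yq)] := totF _ _ FX FY; [exists Y|exists X].
split.
- move=> x y z [X FX Xz]; have [/(_ _ _ _ Xz) + _ _] := FP _ FX.
  move=> [[a ?] [b ?] [c ?]].
  by split; [exists a|exists b|exists c]; exists X.
- move=> x y [z Gz] [w Gw]; have [X [FX Xz Xw]] := common _ _ Gz Gw.
  have [_ XX _] := FP _ FX.
  have [|u Xu] := XX x y (ex_intro _ _ Xz); first by exists w.
  by exists u, X.
- by move=> p q z /common/[apply] -[X [/FP[_ _]]]; apply.
Qed.

(* A maximal [G] is an injection of the square of its domain into that domain;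
   it could be extended to the domain enlarged by [B], the new values being
   in [B]. *)
Let maximal_extend G (B : set T) : P G -> (forall H, G `<` H -> ~ P H) ->
  B !=set0 -> B `<=` ~` dom G ->
  ~ ((dom G `|` B) `*` (dom G `|` B) #<= B).
Proof.
move=> [G1 G2 G3] maxG [b0 B0] BG /card_le_relP[R [totR injR]].
pose D := dom G `|` B.
pose H := G `|` [set u | [/\ (D `*` D) u.1, ~ (dom G `*` dom G) u.1,
                          B u.2 & R u.1 u.2]].
have HB x y : D x -> D y -> ~ (dom G `*` dom G) (x, y) ->
    exists2 z, B z & H ((x, y), z).
  move=> Dx Dy nxy; have [z Bz Rz] := totR (x, y) (conj Dx Dy).
  by exists z => //; right.
have domH : dom H = D.
  apply/seteqP; split=> x.
    by move=> [z [Gz|[[]]//]]; left; exists z.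
  move=> [[z Gz]|Bx]; first by exists z; left.
  have [||[/BG//]|z _] := @HB x x; [by right|by right|].
  by exists z.
apply: (maxG H).
  split; first by move=> u; left.
  have [||[/BG//]|z _ Hz] := @HB b0 b0; [by right|by right|].
  by move=> /(_ _ Hz) Gz; apply: (BG _ B0); exists z.
split.
- rewrite domH => x y z [/G1[? ? ?]|[[/= ? ?] _ ? _]]; first by split; left.
  by split=> //; right.
- rewrite domH => x y Dx Dy.
  have [[/G2/[apply]-[z Gz]]|nxy] := pselect ((dom G `*` dom G) (x, y)).
    by exists z; left.
  by have [z _] := HB _ _ Dx Dy nxy; exists z.
- move=> p q z [Gp|[_ _ Bp Rp]] [Gq|[_ _ Bq Rq]].
  + exact: G3 Gq.
  + by case: (BG _ Bq); case: p Gp => x y /G1[].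
  + by case: (BG _ Bp); case: q Gq => x y /G1[].
  + exact: injR Rq.
Qed.

Lemma infinite_card_square : [set: T] `*` [set: T] #<= [set: T].
Proof.
have [G [PG maxG]] := Zorn_bigcup P_bigcup.
pose S := dom G.
have SS : S `*` S #<= S.
  have [G1 G2 G3] := PG.
  apply/card_le_relP; exists (fun p z => G (p, z)); split=> //.
  move=> [x y] [/G2/[apply] -[z Gz]]; exists z => //.
  by have [] := G1 _ _ _ Gz.
(* A finite [S] is not maximal: its complement contains a sequence [e], and the square of the
   countable set [S] plus [range e] embeds into [range e]. *)
have [finS|infS] := pselect (finite_set S).
  have /infiniteP/card_le_funP[|e eS /in2TT inje] : infinite_set (~` S).
  - by rewrite -setTD; exact: infinite_setD.
  - by exists 0.
  exfalso; apply: (maximal_extend (B := range e) PG maxG).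
  - by exists (e 0), 0.
  - by move=> _ [n _ <-]; exact: eS.
  have cntU : countable (dom G `|` range e).
    apply: card_leU; first exact: infinite_nat.
    - exact: countableX.
    - exact: finite_set_countable.
    - exact: card_image_le.
  apply: card_le_trans (countableX cntU cntU) _.
  apply/card_le_relP; exists (fun n x => e n = x); split.
    by move=> n _; exists (e n) => //; exists n.
  by move=> n m _ <- /inje.
have [SC|CS] := card_le_total S (~` S); last first.
  have TS : [set: T] #<= S by rewrite -(setUv S) card_leU// card_lexx.
  apply: card_le_trans (card_leX TS TS) _.
  exact: card_le_trans SS (subset_card_le _).
have [f fS injf] := card_le_funP (infinite_setN0 infS) SC.
have fSS : f @` S #<= S by exact: card_image_le.
have SfS : S #<= f @` S.
  by have := inj_card_eq injf; rewrite card_eq_le => /andP[].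
exfalso; apply: (maximal_extend (B := f @` S) PG maxG).
- by have [s Ss] := infinite_setN0 infS; exists (f s), s.
- by move=> _ [s Ss <-]; exact: fS.
have SfSS : S `|` f @` S #<= S by rewrite card_leU// card_lexx.
exact: card_le_trans (card_leX SfSS SfSS) (card_le_trans SS SfS).
Qed.

Lemma infinite_pair_inj : exists p : T * T -> T, injective p.
Proof. by apply/card_leTP; rewrite -setXTT infinite_card_square. Qed.

Lemma infinite_seq_inj : exists c : seq T -> T, injective c.
Proof.
have [p injp] := infinite_pair_inj.
have [e inje] : exists e : nat -> T, injective e.
  by apply/card_leTP; exact/infiniteP.
(* The iterated pairing has no end mark, since [e 0] may itself be a pair; recording the length
   makes the code injective. *)
pose fold s := foldr (fun x a => p (x, a)) (e 0) s.
exists (fun s => p (e (size s), fold s)) => s t /injp[/inje + st].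
elim: s t st => [|x s IH] [|y t]//= /injp[-> st] [sz].
by rewrite (IH _ st sz).
Qed.

End infinite_square.

Lemma infinite_setXX_le T (A : set T) : infinite_set A -> A `*` A #<= A.
Proof.
move=> infA; have infA' : infinite_set [set: A].
  by rewrite (eq_finite_set (card_setT A)).
have /card_eqPle[TA AT] := card_setT A.
apply: card_le_trans (card_leX AT AT) _.
exact: card_le_trans (infinite_card_square infA') TA.
Qed.

Lemma card_ge2_distinct T (A : set T) : `I_2 #<= A -> exists x y : T, x <> y.
Proof.
move=> /card_le_funP[|f _ injf]; first by exists 0%N.
exists (f 0%N), (f 1%N) => /injf; rewrite !inE => H.
by have : 0%N = 1%N by apply: H.
Qed.

Local Open Scope ring_scope.

(** * Approximation on boxes of a product *)

Lemma compact_metric_base (R : realType) (M : metricType R) (x0 : M) :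
  compact [set: M] ->
  exists U : nat -> set M, (forall n, open (U n)) /\
    forall x V, nbhs x V -> exists2 n, U n x & U n `<=` V.
Proof.
pose M' : pseudoPMetricType R := HB.pack (Metric.sort M) (isPointed.Build M x0).
move=> cM; have [B cntB [Bop Bbase]] := @compact_second_countable R M' cM.
(* A countable base is empty or enumerated by [nat]; the point [x0] excludes the former. *)
have [B0|[U]] := pfcard_geP cntB.
  have [] := Bbase x0 _ (@filterT _ (nbhs (x0 : M')) _).
  by move=> V; rewrite B0 => -[].
exists U; split=> [n|x V xV]; first exact/Bop/(@funS _ _ _ _ U).
have [W [BW Wx] WV] := Bbase x V xV.
by have [n _ UW] := @surj _ _ _ _ U W BW; exists n; rewrite UW.
Qed.

(* [compact_cover] is stated for pointed spaces only. *)
Lemma compact_cover_compact (T : topologicalType) (A : set T) :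
  compact A -> cover_compact A.
Proof.
have [[x0 _]|A0] := pselect (A !=set0).
  pose T' : ptopologicalType :=
    HB.pack (Topological.sort T) (isPointed.Build T x0).
  by move=> cA; have := cA : @compact T' A; rewrite compact_cover.
move=> _ I D f _ _; exists (fset_set set0); rewrite ?fset_set0// => x Ax.
by case: A0; exists x.
Qed.

Section boxes.
Context {R : realType} {Gamma : choiceType} {X : Gamma -> metricType R}.
Context (U : forall g, nat -> set (X g)).
Arguments U : clear implicits.
Hypothesis U_open : forall g n, open (U g n).
Hypothesis U_base : forall g x V, nbhs x V ->
  exists2 n, U g n x & U g n `<=` V.

Local Notation P := (prod_topology X).

(** Basic open sets are given by finite lists so that they can be coded in [Gamma] and the
    coordinates they restrict can be read off. *)
Definition box (l : seq (Gamma * nat)) : set P :=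
  [set x | forall p, p \in l -> U p.1 p.2 (x p.1)].

Lemma box_cat l1 l2 : box (l1 ++ l2) = box l1 `&` box l2.
Proof.
apply/seteqP; split=> x.
  by move=> lx; split=> p pl; apply: lx; rewrite mem_cat pl ?orbT.
by move=> [l1x l2x] p; rewrite mem_cat => /orP[/l1x|/l2x].
Qed.

Lemma box_open l : open (box l).
Proof.
elim: l => [|p l IH].
  rewrite (_ : box _ = setT); first exact: openT.
  by apply/seteqP; split.
rewrite (_ : box _ = (proj p.1 @^-1` U p.1 p.2) `&` box l).
  apply: openI => //; apply: open_comp => // x _; exact: proj_continuous.
apply/seteqP; split=> x.
  move=> lx; split; first by apply: lx; rewrite mem_head.
  by move=> q ql; apply: lx; rewrite inE ql orbT.
by move=> [px lx] q; rewrite inE => /orP[/eqP->//|/lx].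
Qed.

Lemma box_base (x : P) V : nbhs x V -> exists2 l, box l x & box l `<=` V.
Proof.
(* The boxes around [x] generate a filter. It is enough that this filter converges to [x], which is
   checked one coordinate at a time. *)
have FF : Filter (filter_from [set l | box l x] box).
  apply: filter_from_filter; first by exists [::].
  by move=> l1 l2 /= l1x l2x; exists (l1 ++ l2); rewrite box_cat.
suff : filter_from [set l | box l x] box --> x by apply.
apply/cvg_sup => g A [_ [[V' oV' <-] V'x] V'A].
have [n Unx UnV] : exists2 n, U g n (x g) & U g n `<=` V'.
  by apply: U_base; exact: open_nbhs_nbhs.
exists [:: (g, n)] => /=; first by move=> p; rewrite inE => /eqP->.
by move=> y /(_ (g, n) (mem_head _ _)) /UnV /V'A.
Qed.

(** Such an [s] is a finite code of [f] up to [e]. Functions with a common code are less than [2e]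
    apart at every point, and changing a coordinate that the code does not mention moves [f] by less
    than [2e]. *)
Definition approximates (e : R) (f : P -> R)
    (s : seq (seq (Gamma * nat) * rat)) : Prop :=
  (forall x, exists2 c, c \in s & box c.1 x) /\
  (forall c y, c \in s -> box c.1 y -> `|f y - ratr c.2| < e).

Lemma approximates_exists (f : P -> R) (e : R) :
  compact [set: P] -> continuous f -> 0 < e -> exists s, approximates e f s.
Proof.
move=> /compact_cover_compact cP cf e0.
pose D := [set c : seq (Gamma * nat) * rat |
  forall y, box c.1 y -> `|f y - ratr c.2| < e].
have [|x _|s sD Ps] := cP _ D (fun c => box c.1).
- by move=> c _; exact: box_open.
- have [q] : exists q : rat, ratr q \in `]f x - e, f x + e[%R.
    by apply: rat_in_itvoo; rewrite ltrD2l gtrN.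
  rewrite in_itv/= => /andP[q1 q2].
  have qe : `|f x - ratr q| < e by rewrite ltr_distlC q1 q2.
  have [|l lx lV] := @box_base x [set y | `|f y - ratr q| < e].
    have /cvgr_distC_lt : f y @[y --> x] --> f x by exact: cf.
    (* This radius is what the triangle inequality through [f x] leaves over. *)
    move=> /(_ (e - `|f x - ratr q|)); rewrite subr_gt0 => /(_ qe).
    apply: filterS => y fxy; rewrite /=.
    rewrite -(subrK (f x) (f y)) -addrA (le_lt_trans (ler_normD _ _))//.
    by rewrite -ltrBrDr.
  by exists (l, q) => //= y /lV.
- exists (finmap.enum_fset s); split=> [x|c y /sD/set_mem]; last exact.
  by have [c cs cx] := Ps x I; exists c.
Qed.

Lemma approximates_dist e (f g : P -> R) s x :
  approximates e f s -> approximates e g s -> `|f x - g x| < e + e.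
Proof.
move=> [cov fs] [_ gs]; have [c cs cx] := cov x.
rewrite (le_lt_trans (ler_distD (ratr c.2) _ _))// ltrD//; first exact: fs.
by rewrite distrC; exact: gs.
Qed.

(** The box of the code that contains [x] does not restrict the coordinate [g], hence contains [y]
    too; both values are close to the same rational. *)
Lemma approximates_indep e (f : P -> R) s g (x y : P) :
  approximates e f s -> (forall c, c \in s -> g \notin map fst c.1) ->
  (forall i, i != g -> x i = y i) -> `|f x - f y| < e + e.
Proof.
move=> [cov fs] sg xy; have [c cs cx] := cov x.
rewrite (le_lt_trans (ler_distD (ratr c.2) _ _))// ltrD//; first exact: fs.
rewrite distrC; apply: fs => // p pc; rewrite -xy; first exact: cx.
by apply: contra (sg _ cs) => /eqP <-; exact: map_f.
Qed.

End boxes.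

(** * Extending equilateral sets *)

Lemma mdist_continuous (R : realType) (M : metricType R) (p : M) :
  continuous (mdist p : M -> R).
Proof.
move=> x; apply/cvgrPdist_lt => e e0; apply/nbhs_ballP; exists e => //= y.
rewrite ballEmdist /= => xy; rewrite ltr_norml.
have := metric_triangle p x y; have := metric_triangle p y x.
rewrite (metric_sym y x) => h1 h2; apply/andP; split; lra.
Qed.

(** The distance to [p], scaled to be 1 at [q] and cut off at 1. *)
Lemma metric_separation (R : realType) (M : metricType R) (p q : M) : p <> q ->
  exists t : M -> R, [/\ continuous t, forall x, 0 <= t x <= 1,
                         t p = 0 & t q = 1].
Proof.
move=> /eqP pq; have d0 : 0 < mdist p q by rewrite mdist_gt0.
exists (fun x => Num.min 1 (mdist p x / mdist p q)); split.
- move=> x.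
  apply: (@continuous_min _ _ (cst 1) (fun y => mdist p y / mdist p q)).
    exact: cvg_cst.
  by apply: cvgM; [exact: mdist_continuous|exact: cvg_cst].
- by move=> x; rewrite ge_min lexx le_min ler01 divr_ge0 ?mdist_ge0.
- by rewrite mdistxx mul0r min_r.
- by rewrite divff ?gt_eqF// minxx.
Qed.

Lemma finite_argmin (R : realDomainType) (T : Type) (A : set T) (v : T -> R) :
  finite_set A -> A !=set0 -> exists2 a, A a & forall b, A b -> v a <= v b.
Proof.
elim/Pchoice: T => T in A v *; move=> /finite_seqP[s ->] {A} [a /=].
elim: s a => // a [|b s] IH _ _.
  by exists a; [exact: mem_head|move=> b; rewrite /= inE => /eqP->].
have [c /= cs cP] := IH b (mem_head _ _).
have [ac|ca] := leP (v a) (v c).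
  exists a; first exact: mem_head.
  by move=> d; rewrite /= inE => /orP[/eqP->//|/cP]; exact: le_trans.
exists c; first by rewrite /= inE cs orbT.
by move=> d; rewrite /= inE => /orP[/eqP->|/cP//]; exact: ltW.
Qed.

Section extension.
Context {R : realType} {T : topologicalType} (cT : compact [set: T]).
Local Notation C := (Cspace R cT).
Implicit Types (f g : C) (A : set C).

Lemma Cspace_le_dist f g x : `|f x - g x| <= `|f - g|.
Proof. by rewrite -CspaceN -CspaceD; exact: le_sup_norm. Qed.

Lemma Cspace_dist_le f g r :
  0 <= r -> (forall x, `|f x - g x| <= r) -> `|f - g| <= r.
Proof. by move=> r0 H; apply: sup_norm_le => // x; exact: H. Qed.

Lemma Cspace_dist_attained f g : [set: T] !=set0 ->
  exists x, `|f - g| = `|f x - g x|.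
Proof.
move=> T0.
have [|x _ xP] := @compact_EVT_max T R (fun x => `|f x - g x|) _ T0 cT.
  apply: continuous_subspaceT => x; apply: cvg_norm.
  by apply: cvgB; exact: cts_fun.
exists x; apply/eqP; rewrite eq_le Cspace_le_dist andbT Cspace_dist_le// => y.
by apply: xP; rewrite inE.
Qed.

Lemma not_maximal_extend A l g : 0 < l ->
  (forall f f', A f -> A f' -> f <> f' -> `|f - f'| = l) ->
  (forall f, A f -> `|f - g| = l) -> ~ maximal_equilateral A.
Proof.
move=> l0 Al gl [_ maxA]; apply: maxA; exists (A `|` [set g]).
  exists l => // f f' [Af|->] [Af'|->] ff'; rewrite Cspace_mdistE.
  - exact: Al.
  - exact: gl.
  - by rewrite distrC gl.
  - by [].
split; first by move=> f; left.
move=> /(_ g (or_intror erefl)) /gl; rewrite subrr normr0 => l0'.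
by rewrite -l0' ltxx in l0.
Qed.

(** Here [f0] and the list [s] are members of an equilateral set of distance [l]. The two-sided
    bounds keep [g] within [l] of all of them; the value at [z] gives distance [l] from [f0], and
    the value at [y f], where [f] and [f0] will be [l] apart, gives distance [l] from [f]. *)
Lemma peak_function (f0 : C) (l : R) (z : T) (y : C -> T) (s : seq C) :
  (forall x1 x2 : T, x1 <> x2 -> exists t : C,
    [/\ forall x, 0 <= t x <= 1, t x1 = 0 & t x2 = 1]) -> 0 <= l ->
  (forall f, f \in s ->
    [/\ y f <> z, f0 z <= f z & forall x, f0 x <= f x + l]) ->
  exists g : C, [/\ g z = f0 z + l, forall x, f0 x <= g x <= f0 x + l &
    forall f, f \in s -> g (y f) = f0 (y f) /\ forall x, g x <= f x + l].
Proof.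
move=> sep l0; elim: s => [_|h s IH hP].
  have cg : continuous (fun x => f0 x + l).
    by move=> x; apply: cvgD; [exact: cts_fun|exact: cvg_cst].
  by exists (mkcts cg : C); split=> //= x; rewrite lexx lerDl l0.
have [|g [gz g01 gP]] := IH.
  by move=> f fs; apply: hP; rewrite inE fs orbT.
have [yz hz hx] := hP h (mem_head _ _).
have [t [t01 ty tz]] := sep _ _ yz.
(* The cap [h + l] leaves the value at [z] alone because [f0 z <= h z]. The cap [f0 + l * t] forces
   the value [f0] at [y h] and is harmless at [z], where [t] is 1. *)
pose u x := Num.min (g x) (Num.min (h x + l) (f0 x + l * t x)).
have cu : continuous u.
  move=> x; apply: (@continuous_min _ _ (g : T -> R)
      (fun x => Num.min (h x + l) (f0 x + l * t x))); first exact: cts_fun.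
  apply: (@continuous_min _ _ (fun x => h x + l) (fun x => f0 x + l * t x)).
    by apply: cvgD; [exact: cts_fun|exact: cvg_cst].
  apply: cvgD; first exact: cts_fun.
  by apply: cvgM; [exact: cvg_cst|exact: cts_fun].
have f0u x : f0 x <= u x.
  rewrite !le_min hx lerDl mulr_ge0 ?andbT//; last by case/andP: (t01 x).
  by case/andP: (g01 x).
have ug x : u x <= g x by rewrite /u ge_min lexx.
have uh x : u x <= h x + l by rewrite /u !ge_min lexx orbT.
exists (mkcts cu : C); split => /=.
- by rewrite /mkcts /u tz mulr1 gz (@min_r _ _ (h z + l)) ?lerD2r// minxx.
- move=> x; rewrite f0u (le_trans (ug x))//.
  by case/andP: (g01 x).
- move=> f; rewrite inE => /orP[/eqP->|/gP[gf gl]]; split=> //.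
  + apply/eqP; rewrite eq_le f0u andbT.
    by rewrite /mkcts /u ty mulr0 addr0 !ge_min lexx !orbT.
  + by apply/eqP; rewrite eq_le f0u andbT -gf ug.
  + by move=> x; exact: le_trans (gl x).
Qed.

Lemma maximal_equilateral_infinite A : infinite_set [set: T] ->
  (forall x1 x2 : T, x1 <> x2 -> exists t : C,
    [/\ forall x, 0 <= t x <= 1, t x1 = 0 & t x2 = 1]) ->
  maximal_equilateral A -> infinite_set A.
Proof.
move=> infT sep maxA finA; have [[l l0 Al] _] := maxA.
have T0 : [set: T] !=set0 := infinite_setN0 infT.
have [A0|A0] := pselect (A !=set0); last first.
  apply: (@not_maximal_extend A l 0 l0 Al _ maxA) => f Af.
  by case: A0; exists f.
have /choice[y yP] : forall p : C * C, exists x,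
    `|p.1 - p.2| = `|p.1 x - p.2 x|.
  by move=> p; exact: Cspace_dist_attained.
(* Only finitely many points are chosen as places where distances are attained, so some [z] avoids
   them all. *)
have [z [_ zy]] : ([set: T] `\` y @` (A `*` A)) !=set0.
  apply/infinite_setN0/infinite_setD => //.
  by apply: finite_image; exact: finite_setX.
(* Minimality at [z] provides the hypothesis [f0 z <= f z] of [peak_function]. *)
have [f0 Af0 f0min] := finite_argmin (fun f : C => f z) finA A0.
have /finite_seqP[s As] := finA.
have As' f : f \in s -> A f by rewrite As.
have [|g [gz g01 gP]] := @peak_function f0 l z (fun f => y (f0, f))
    [seq f <- s | f != f0] sep (ltW l0).
  move=> f; rewrite mem_filter => /andP[ff0 /As' Af]; split.
  - by move=> yz; apply: zy; exists (f0, f).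
  - exact: f0min.
  - move=> x; have := Cspace_le_dist f0 f x.
    rewrite -Cspace_mdistE (Al f0 f)//; last by apply/eqP; rewrite eq_sym.
    by rewrite ler_norml => /andP[_]; rewrite lerBlDl.
apply: (@not_maximal_extend A l g l0 Al _ maxA) => f Af.
apply/eqP; rewrite eq_le; have [->|ff0] := eqVneq f f0.
  apply/andP; split.
    apply: Cspace_dist_le; first exact: ltW.
    by move=> x; have /andP[] := g01 x; rewrite ler_norml; lra.
  apply: le_trans (Cspace_le_dist _ _ z); rewrite gz opprD addNKr normrN.
  exact: ler_norm.
have dl : `|f0 - f| = l.
  by rewrite -Cspace_mdistE Al//; apply/eqP; rewrite eq_sym.
have [|gy gf] := gP f.
  by rewrite mem_filter ff0 -[is_true _]/([set` s] f) -As.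
apply/andP; split.
  apply: Cspace_dist_le; first exact: ltW.
  move=> x; have := gf x; have /andP[+ _] := g01 x.
  have := Cspace_le_dist f0 f x; rewrite dl !ler_norml; lra.
apply: le_trans (Cspace_le_dist _ _ (y (f0, f))); rewrite gy distrC.
by have := yP (f0, f); rewrite /= dl => <-.
Qed.

(** The maps [r0] and [r1] move a point to where [t] is 0 or 1 without changing the value of any
    member of [A]. The convex combination [g] of [f0] and [f1] is within [l] of [A]. It equals [f0]
    at each [r0 x], so it is as far as [f0] from any other [f]; its distance from [f0] is seen at
    the points [r1 x], where it equals [f1]. *)
Lemma not_maximal_of_retractions A (f0 f1 t : C) (r0 r1 : T -> T) :
  A f0 -> A f1 -> f0 <> f1 -> (forall x, 0 <= t x <= 1) ->
  (forall x, t (r0 x) = 0) -> (forall x, t (r1 x) = 1) ->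
  (forall f x, A f -> f (r0 x) = f x /\ f (r1 x) = f x) ->
  ~ maximal_equilateral A.
Proof.
move=> Af0 Af1 f01 t01 t0 t1 Ar maxA; have [[l l0 Al] _] := maxA.
have cg : continuous (fun x => (1 - t x) * f0 x + t x * f1 x).
  move=> x; apply: cvgD; apply: cvgM; try exact: cts_fun.
  by apply: cvgB; [exact: cvg_cst|exact: cts_fun].
pose g : C := mkcts cg.
have gE x : g x = (1 - t x) * f0 x + t x * f1 x by [].
have dl f f' x : A f -> A f' -> `|f x - f' x| <= l.
  move=> Af Af'; have [->|/eqP ff'] := eqVneq f f'.
    by rewrite subrr normr0 ltW.
  by rewrite -(Al _ _ Af Af' ff') Cspace_mdistE Cspace_le_dist.
apply: (@not_maximal_extend A l g l0 Al _ maxA) => f Af.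
apply/eqP; rewrite eq_le; apply/andP; split.
  apply: Cspace_dist_le; first exact: ltW.
  move=> x; rewrite gE.
  have -> : f x - ((1 - t x) * f0 x + t x * f1 x) =
      (1 - t x) * (f x - f0 x) + t x * (f x - f1 x) by ring.
  rewrite (le_trans (ler_normD _ _))// !normrM.
  have /andP[tx0 tx1] := t01 x.
  rewrite (ger0_norm tx0) ger0_norm ?subr_ge0//.
  have := dl f f0 x Af Af0; have := dl f f1 x Af Af1; nra.
have [->|/eqP ff0] := eqVneq f f0.
  rewrite -(Al _ _ Af0 Af1 f01) Cspace_mdistE; apply: Cspace_dist_le => // x.
  have := Cspace_le_dist f0 g (r1 x); rewrite gE t1 subrr mul0r add0r mul1r.
  by rewrite !(Ar _ x _).2.
rewrite -(Al _ _ Af Af0 ff0) Cspace_mdistE; apply: Cspace_dist_le => // x.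
have := Cspace_le_dist f g (r0 x); rewrite gE t0 subr0 mul0r addr0 mul1r.
by rewrite !(Ar _ x _).1.
Qed.

Lemma maximal_equilateral_exists : [set: T] !=set0 ->
  exists A, maximal_equilateral A.
Proof.
move=> [x0 _].
have c1 : continuous (cst 1 : T -> R) by move=> x; exact: cvg_cst.
pose one : C := mkcts c1.
pose E := [set B : set C |
  forall f f', B f -> B f' -> f <> f' -> `|f - f'| = 1].
(* Two points in [S0] fix the distance 1 for any equilateral extension. *)
pose S0 : set C := [set 0; one].
have ES0 : E S0.
  have d1 : `|one - 0 : C| = 1.
    rewrite subr0; apply/eqP; rewrite eq_le; apply/andP; split.
      by apply: sup_norm_le => // x; rewrite normr1.
    by have := le_sup_norm one x0; rewrite normr1.
  by move=> f f' [->|->] [->|->] //; rewrite distrC.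
(* The property is stated for [B] joined with [S0] so that it also holds for the union of the empty
   chain. *)
have [F FP totF|B [EB maxB]] := @Zorn_bigcup _ (fun B => E (B `|` S0)).
  move=> f f' Hf Hf'.
  have [[X FX [Xf Xf']]|nX] :=
      pselect (exists2 X, F X & (X `|` S0) f /\ (X `|` S0) f').
    exact: FP FX _ _ Xf Xf'.
  have [[X FX Xf]|Sf] := Hf; have [[Y FY Yf']|Sf'] := Hf'.
  - case: nX; have [XY|YX] := totF _ _ FX FY.
      by exists Y => //; split; left=> //; exact: XY.
    by exists X => //; split; left=> //; exact: YX.
  - by case: nX; exists X => //; split; [left|right].
  - by case: nX; exists Y => //; split; [right|left].
  - exact: ES0.
exists (B `|` S0); split.
  by exists 1 => // f f'; rewrite Cspace_mdistE; exact: EB.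
move=> [D [l l0 Dl] [BD DB]]; have [D0 D1] : D 0 /\ D one.
  by split; apply: BD; right; [left|right].
have one0 : one <> 0.
  by move=> e; have : one x0 = 0 by [rewrite e]; move/eqP; rewrite oner_eq0.
have l1 : l = 1.
  by rewrite -(Dl _ _ D1 D0 one0) Cspace_mdistE EB//; right; [right|left].
apply: (maxB D).
  split; first by move=> f Bf; apply: BD; left.
  by move=> DB'; apply: DB => f /DB' Bf; left.
have -> : D `|` S0 = D by apply/setUidPl => f S0f; apply: BD; right.
by move=> f f' Df Df' ff'; rewrite -l1 -Cspace_mdistE; exact: Dl.
Qed.

End extension.

(** * Products of compact metric spaces *)

Section product.
Context {R : realType} {Gamma : choiceType} (X : Gamma -> metricType R).
Hypothesis infGamma : infinite_set [set: Gamma].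
Hypothesis cX : forall g, compact [set: X g].
Context (p q : forall g, X g).
Hypothesis pq : forall g, p g <> q g.

Local Notation P := (prod_topology X).
Local Notation C := (Cspace R (compact_prod_topology cX)).
Implicit Types (f : C) (A : set C) (g : Gamma).

Let code_type := seq (seq (Gamma * nat) * rat).

(** Naturals, pairs and finite lists over the infinite [Gamma] all embed into [Gamma]; rationals
    enter through their numbering by [pickle]. *)
Lemma code_inj : exists c : code_type -> Gamma, injective c.
Proof.
have [d injd] := infinite_pair_inj infGamma.
have [c injc] := infinite_seq_inj infGamma.
have [e inje] : exists e : nat -> Gamma, injective e.
  by apply/card_leTP; exact/infiniteP.
pose i (u : Gamma * nat) := d (u.1, e u.2).
have inji : injective i by move=> [g m] [g' m'] /injd[-> /inje ->].
pose j (u : seq (Gamma * nat) * rat) := d (c (map i u.1), e (pickle u.2)).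
have injj : injective j.
  move=> [s r] [s' r'] /injd[/injc/(inj_map inji) -> /inje].
  by move=> /(pcan_inj pickleK) ->.
by exists (c \o map j) => s s' /injc/(inj_map injj).
Qed.

Lemma prod_infinite : infinite_set [set: P].
Proof.
suff : [set: Gamma] #<= [set: P].
  by move=> /card_le_finite H /H.
(* Changing [p] to [q] at a single coordinate gives a different point for each coordinate. *)
apply/card_leTP; exists (fun g => dfwith p g (q g)) => g g' e.
apply: contrapT => /eqP gg'; apply: (@pq g').
have := congr1 (fun x : P => x g') e.
by rewrite dfwithout// dfwithin.
Qed.

Lemma comp_proj_continuous (M : topologicalType) g (t : X g -> M) :
  continuous t -> continuous (fun x : P => t (x g)).
Proof.
move=> ct x; apply: (@cvg_comp _ _ _ (@proj _ X g) t _ (nbhs (x g))).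
  exact: proj_continuous.
exact: ct.
Qed.

Lemma prod_separation (x1 x2 : P) : x1 <> x2 -> exists t : C,
  [/\ forall x, 0 <= t x <= 1, t x1 = 0 & t x2 = 1].
Proof.
move=> x12; have [g xg] : exists g, x1 g <> x2 g.
  apply: contrapT => /forallNP H; apply: x12.
  by apply: functional_extensionality_dep => g; apply: contrapT.
have [t [ct t01 t1 t2]] := metric_separation xg.
by exists (mkcts (comp_proj_continuous ct) : C); split=> //= x; exact: t01.
Qed.

Lemma code_exists : exists code : C -> R -> code_type, exists
  U : forall g, nat -> set (X g),
  forall f e, 0 < e -> approximates U e f (code f e).
Proof.
pose U g := projT1 (cid (compact_metric_base (p g) (@cX g))).
have UP g := projT2 (cid (compact_metric_base (p g) (@cX g))).
have /choice[code codeP] : forall fe : C * R, exists s,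
    0 < fe.2 -> approximates U fe.2 fe.1 s.
  move=> [f e] /=; have [e0|e0] := ltP 0 e; last by exists [::].
  have [s fs] := approximates_exists (fun g => (UP g).1) (fun g => (UP g).2)
    (compact_prod_topology cX) (@cts_fun _ _ f) e0.
  by exists s.
exists (fun f e => code (f, e)), U => f e; exact: (codeP (f, e)).
Qed.

Lemma equilateral_card_le A : equilateral A -> A #<= [set: Gamma].
Proof.
move=> [l l0 Al]; have [code [U codeP]] := code_exists.
(* Members with the same code at precision [l / 3] are at most [2l / 3 < l] apart, hence equal. *)
have [c injc] := code_inj; have l3 : 0 < l / 3 by rewrite divr_gt0.
apply/card_le_relP; exists (fun f g => A f /\ c (code f (l / 3)) = g); split.
  by move=> f Af; exists (c (code f (l / 3))).
move=> f f' _ [Af <-] [Af' /injc ff']; apply: contrapT => nff'.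
have := Al _ _ Af Af' nff'; rewrite Cspace_mdistE => dff'.
suff : `|f - f'| <= l / 3 + l / 3 by rewrite dff'; lra.
apply: Cspace_dist_le; first by rewrite ltW ?addr_gt0.
move=> x; apply/ltW/approximates_dist; first exact: codeP.
by rewrite -ff'; exact: codeP.
Qed.

Lemma maximal_equilateral_card_ge A :
  maximal_equilateral A -> [set: Gamma] #<= A.
Proof.
move=> maxA; have infA : infinite_set A.
  exact: maximal_equilateral_infinite prod_infinite prod_separation maxA.
have [code [U codeP]] := code_exists.
pose coords f n := flatten [seq map fst c.1 | c <- code f n.+1%:R^-1].
(* If every coordinate is used, it is determined by a member [f], a precision [n] and a position in
   the list [coords f n]; so [Gamma] embeds into [A * nat * nat], hence into [A]. *)
have [used|] := pselect (forall g, exists f n, A f /\ g \in coords f n).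
  have AN : [set: nat] #<= A by exact/infiniteP.
  apply: card_le_trans (infinite_setXX_le infA).
  apply: card_le_trans (card_leX (infinite_setXX_le infA) (card_lexx A)).
  apply: card_le_trans (card_leX (card_leX (card_lexx A) AN) AN).
  apply/card_le_relP.
  exists (fun g u => onth (coords u.1.1 u.1.2) u.2 = Some g).
  split=> [g _|g g' u -> []//].
  have [f [n [Af gf]]] := used g; exists (f, n, index g (coords f n)) => //=.
  by rewrite onthE (nth_map g) ?index_mem// nth_index.
move=> /existsNP[g /forallNP ng].
have indep f (x y : P) : A f -> (forall i, i != g -> x i = y i) -> f x = f y.
  move=> Af xy; apply/eqP; rewrite -subr_eq0 -normr_le0.
  apply/ler_addgt0Pl => e e0; rewrite addr0.
  have [n nP] := @ltr_add_invr R 0 (e / 2) (divr_gt0 e0 (ltr0Sn _ _)).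
  rewrite add0r in nP.
  have lt : `|f x - f y| < n.+1%:R^-1 + n.+1%:R^-1.
    apply: approximates_indep xy; first by apply: codeP; rewrite invr_gt0.
    move=> c cc; apply/negP => gc; have /forallNP/(_ n) := ng f; apply.
    split=> //; apply/flattenP; exists (map fst c.1) => //.
    by apply/mapP; exists c.
  by apply/ltW/(lt_trans lt); rewrite [ltRHS]splitr ltrD.
have [f0 Af0] := infinite_setN0 infA.
have [f1 [Af1 f10]] : (A `\` [set f0]) !=set0.
  by apply/infinite_setN0/infinite_setD => //; exact: finite_set1.
have [t [ct t01 tp tq]] := metric_separation (@pq g).
(* The retractions reset the coordinate [g] to [p g] and to [q g]. *)
exfalso; apply: (@not_maximal_of_retractions _ _ _ A f0 f1
  (mkcts (comp_proj_continuous ct) : C)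
  (fun x => dfwith x g (p g)) (fun x => dfwith x g (q g)))
  => //.
- by move=> e; apply: f10; rewrite e.
- by move=> x; exact: t01.
- by move=> x; rewrite -[LHS]/(t (dfwith x g (p g) g)) dfwithin.
- by move=> x; rewrite -[LHS]/(t (dfwith x g (q g) g)) dfwithin.
- by move=> f x Af; split; apply: indep => // i ig; rewrite dfwithout// eq_sym.
Qed.

Lemma is_m_Cspace_prod : is_m C [set: Gamma].
Proof.
have [A maxA] := @maximal_equilateral_exists R _ (compact_prod_topology cX)
  (infinite_setN0 prod_infinite).
split; last exact: maximal_equilateral_card_ge.
exists A => //; rewrite card_eq_le maximal_equilateral_card_ge// andbT.
by apply: equilateral_card_le; case: maxA.
Qed.

End product.

Theorem theorem4 (R : realType) (Gamma : Type) (X : Gamma -> metricType R)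
    (infGamma : infinite_set [set: Gamma])
    (cX : forall gamma, compact [set: X gamma])
    (X_ge2 : forall gamma, `I_2 #<= [set: X gamma]) :
  is_m (Cspace R (compact_prod_topology cX)) [set: Gamma].
Proof.
have dist g := cid (card_ge2_distinct (X_ge2 g)).
exact: (@is_m_Cspace_prod R {classic Gamma} X infGamma cX
  (fun g => projT1 (dist g)) _ (fun g => projT2 (cid (projT2 (dist g))))).
Qed.
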